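(* Let $\varphi$ be a finite conjunction of literals of the two forms $x\in y$ and $x = y\setminus z$ (with $x,y,z$ set variables), with finite set of variables $\mathrm{Vars}(\varphi)$. Let $M$ be a set assignment over $\mathrm{Vars}(\varphi)$ satisfying $\varphi$; let $\bar x,\bar y\in\mathrm{Vars}(\varphi)$, let $\overline{M}$ be a set assignment over $\mathrm{Vars}(\varphi)$ satisfying $\varphi$ with $\overline{M}\bar x\neq \overline{M}\bar y$, and let $\mathfrak{t}$ be a set belonging to exactly one of $\overline{M}\bar x$, $\overline{M}\bar y$. Fix a set $\mathfrak{s}$ with $\mathrm{rk}(\mathfrak{s})>\mathrm{rk}(M)$. Define $\mathsf{V}_0=\{u\in\mathrm{Vars}(\varphi)\mid \mathfrak{t}\in\overline{M}u\}$; $\mathsf{V}_n=\{u\in\mathrm{Vars}(\varphi)\mid Mu\cap\{Mw\mid w\in\mathsf{V}_{n-1}\}\neq\emptyset\}$ for $n\ge1$; $M_0v=Mv\cup\{\mathfrak{s}\}$ if $v\in\mathsf{V}_0$ and $M_0v=Mv$ otherwise; for $n\ge1$, $M_nv=M_{n-1}v\cup\{M_{n-1}u\mid u\in\mathsf{V}_{n-1},\ Mu\in Mv\}$ if $v\in\mathsf{V}_n$ and $M_nv=M_{n-1}v$ otherwise. Let $k\in\mathbb{N}$. Then: (a) if $\mathsf{V}_k=\emptyset$, then for all $n\ge k$ we have $\mathsf{V}_n=\emptyset$ and $M_n=M_k$; (b) if $\mathsf{V}_k\neq\emptyset$, then $k\le\min(|\mathrm{Vars}(\varphi)|-1,\ 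\mathrm{rk}(M))$.
   Context: A set assignment is a map from a finite set of set variables into the von Neumann universe $\mathcal{V}=\bigcup_\alpha\mathcal{V}_\alpha$, $\mathcal{V}_\alpha=\bigcup_{\beta<\alpha}\mathcal{P}(\mathcal{V}_\beta)$; it satisfies $x\in y$ iff $Mx\in My$ and $x=y\setminus z$ iff $Mx=My\setminus Mz$. The rank $\mathrm{rk}(s)$ of a set $s$ is the least ordinal $\alpha$ with $s\subseteq\mathcal{V}_\alpha$, and $\mathrm{rk}(M)=\max\{\mathrm{rk}(Mx)\mid x\in\mathrm{dom}(M)\}$. *)

(* Defs.v *)
(* Stdlib + mathcomp boot (seq) world.  Sets of the von Neumann universe are
   modelled by Aczel's well-founded trees with extensional equality. *)
From Stdlib Require Import ClassicalEpsilon.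
From mathcomp Require Import all_boot.

Set Implicit Arguments.
Unset Strict Implicit.
Unset Printing Implicit Defensive.

Inductive V : Type := sup : forall (A : Type), (A -> V) -> V.
Arguments sup : clear implicits.

Definition idx (x : V) : Type := match x with sup A _ => A end.
Definition elt (x : V) : idx x -> V := match x with sup _ f => f end.
Arguments elt : clear implicits.

Fixpoint Veq (x y : V) {struct x} : Prop :=
  match x, y with
  | sup A f, sup B g =>
      (forall a, exists b, Veq (f a) (g b)) /\ (forall b, exists a, Veq (f a) (g b))
  end.

Definition Vin (x y : V) : Prop := exists b : idx y, Veq x (elt y b).
Definition Vsub (x y : V) : Prop := forall z, Vin z x -> Vin z y.

Definition Vsingleton (s : V) : V := sup unit (fun _ => s).
Definition Vunion (x y : V) : V :=
  sup (idx x + idx y)%type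
      (fun p => match p with inl a => elt x a | inr b => elt y b end).
Definition Vdiff (x y : V) : V :=
  sup {a : idx x | ~ Vin (elt x a) y} (fun p => elt x (proj1_sig p)).
Definition Vbigcup (I : Type) (F : I -> V) : V :=
  sup {i : I & idx (F i)} (fun p => elt (F (projT1 p)) (projT2 p)).
Definition Vsucc (o : V) : V := Vunion o (Vsingleton o).

(** rank: rk(x) = \bigcup_{y \in x} (rk(y) + 1), i.e. the least ordinal alpha
    with x \subseteq V_alpha; ordinals compared by membership (<) and
    inclusion (<=). *)
Fixpoint rk (x : V) : V :=
  match x with sup A f => Vbigcup (fun a : A => Vsucc (rk (f a))) end.

Fixpoint vnat (n : nat) : V :=
  match n with
  | 0 => sup False (fun f : False => match f with end)
  | S n => Vsucc (vnat n)
  end.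

Inductive lit : Type :=
| LMem  (x y : nat)
| LDiff (x y z : nat).

Definition lit_vars (l : lit) : seq nat :=
  match l with LMem x y => [:: x; y] | LDiff x y z => [:: x; y; z] end.

Definition formula := list lit.

Definition Vars (phi : formula) : seq nat := undup (flatten (map lit_vars phi)).

(** a set assignment: only its values on Vars(phi) matter *)
Definition assignment := nat -> V.

Definition lit_sat (M : assignment) (l : lit) : Prop :=
  match l with
  | LMem x y => Vin (M x) (M y)
  | LDiff x y z => Veq (M x) (Vdiff (M y) (M z))
  end.

Definition sat (M : assignment) (phi : formula) : Prop :=
  forall l, List.In l phi -> lit_sat M l.

Fixpoint Vset (phi : formula) (M Mbar : assignment) (t : V) (n : nat) : nat -> Prop :=
  match n with
  | 0 => fun u => u \in Vars phi /\ Vin t (Mbar u)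
  | S n' => fun u => u \in Vars phi /\
        exists z, Vin z (M u) /\ exists w, Vset phi M Mbar t n' w /\ Veq z (M w)
  end.

Fixpoint Mn (phi : formula) (M Mbar : assignment) (t s : V) (n : nat) : assignment :=
  match n with
  | 0 => fun v =>
      if excluded_middle_informative (Vset phi M Mbar t 0 v)
      then Vunion (M v) (Vsingleton s) else M v
  | S n' => fun v =>
      if excluded_middle_informative (Vset phi M Mbar t (S n') v)
      then Vunion (Mn phi M Mbar t s n' v)
             (sup {u : nat | Vset phi M Mbar t n' u /\ Vin (M u) (M v)}
                  (fun p => Mn phi M Mbar t s n' (proj1_sig p)))
      else Mn phi M Mbar t s n' v
  end.

(* Main.v *)
(* A nonempty V_k unfolds into an ∈-chain M w_0 ∈ M w_1 ∈ … ∈ M w_k of values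
   of M at variables of φ. Ranks strictly increase along an ∈-chain, so the
   w_i are pairwise distinct, whence k + 1 ≤ |Vars(φ)|, and rk(M w_k) ≥ k;
   the latter uses that a rank is comparable with every natural number.
   Conversely V_{n+1} is computed from V_n alone, so once some V_k is empty
   all later ones are, and M_{n+1} = M_n whenever V_{n+1} is empty. *)

Require Import Defs.
From Stdlib Require Import ClassicalEpsilon Classical.
From mathcomp Require Import all_boot.

Set Implicit Arguments.
Unset Strict Implicit.
Unset Printing Implicit Defensive.

Lemma Veq_refl x : Veq x x.
Proof. by elim: x => A f IH /=; split=> a; exists a; apply: IH. Qed.

Lemma Veq_sym x y : Veq x y -> Veq y x.
Proof.
elim: x y => A f IH [B g] /= [fg gf]; split=> [b|a].
- by have [a fg_ab] := gf b; exists a; apply: IH.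
- by have [b fg_ab] := fg a; exists b; apply: IH.
Qed.

Lemma Veq_trans x y z : Veq x y -> Veq y z -> Veq x z.
Proof.
elim: x y z => A f IH [B g] [C h] /= [fg gf] [gh hg]; split=> [a|c].
- have [b fg_ab] := fg a; have [c gh_bc] := gh b.
  by exists c; apply: IH gh_bc.
- have [b gh_bc] := hg c; have [a fg_ab] := gf b.
  by exists a; apply: IH gh_bc.
Qed.

Lemma Vin_Veql x x' y : Veq x x' -> Vin x y -> Vin x' y.
Proof. by move=> xx' [b xb]; exists b; apply: Veq_trans (Veq_sym xx') xb. Qed.

Lemma Vin_Veqr x y y' : Veq y y' -> Vin x y -> Vin x y'.
Proof.
case: y y' => [B g] [C h] /= [gh _] [b xb].
by have [c gh_bc] := gh b; exists c; apply: Veq_trans gh_bc.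
Qed.

Lemma Veq_ext x y : Vsub x y -> Vsub y x -> Veq x y.
Proof.
case: x y => [A f] [B g] xy yx /=; split=> [a|b].
- by apply: xy; exists a; apply: Veq_refl.
- have [a ga] : Vin (g b) (sup A f) by apply: yx; exists b; apply: Veq_refl.
  by exists a; apply: Veq_sym.
Qed.

Lemma Vin_irrefl x : ~ Vin x x.
Proof.
elim: x => A f IH [a fa]; apply: (IH a).
by apply: Vin_Veqr fa _; exists a; apply: Veq_refl.
Qed.

Lemma Vin_union z x y : Vin z (Vunion x y) <-> Vin z x \/ Vin z y.
Proof.
split=> [[/= [a|b] zab]|[[a za]|[b zb]]].
- by left; exists a.
- by right; exists b.
- by exists (inl a).
- by exists (inr b).
Qed.

Lemma Vin_singleton z s : Vin z (Vsingleton s) <-> Veq z s.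
Proof. by split=> [[u zs]|zs]; last exists tt. Qed.

Lemma Vin_succ z o : Vin z (Vsucc o) <-> Vin z o \/ Veq z o.
Proof. by rewrite Vin_union Vin_singleton. Qed.

Lemma Vin_bigcup I (F : I -> V) z : Vin z (Vbigcup F) <-> exists i, Vin z (F i).
Proof.
split=> [[[i b] zb]|[i [b zb]]]; first by exists i, b.
by exists (existT _ i b).
Qed.

Lemma Vin_rk z A (f : A -> V) :
  Vin z (rk (sup A f)) <-> exists a, Vin z (Vsucc (rk (f a))).
Proof. exact: Vin_bigcup. Qed.

Lemma rk_Veq x y : Veq x y -> Veq (rk x) (rk y).
Proof.
elim: x y => A f IH [B g] xy; have [fg gf] := xy.
apply: Veq_ext => z /Vin_rk [a za]; apply/Vin_rk.
- have [b fg_ab] := fg a; exists b.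
  have /Vin_succ [zf|zf] := za; apply/Vin_succ; have rk_ab := IH a _ fg_ab.
  + by left; apply: Vin_Veqr rk_ab zf.
  + by right; apply: Veq_trans rk_ab.
- have [b fg_ba] := gf a; exists b.
  have /Vin_succ [zg|zg] := za; apply/Vin_succ; have rk_ba := Veq_sym (IH b _ fg_ba).
  + by left; apply: Vin_Veqr rk_ba zg.
  + by right; apply: Veq_trans rk_ba.
Qed.

Lemma rk_Vin x y : Vin x y -> Vin (rk x) (rk y).
Proof.
case: y => B g [b xb]; apply/Vin_rk; exists b.
by apply/Vin_succ; right; apply: rk_Veq.
Qed.

Lemma rk_Vsub x y : Vin x y -> Vsub (rk x) (rk y).
Proof.
case: y => B g [b xb] z zx; apply/Vin_rk; exists b.
by apply/Vin_succ; left; apply: Vin_Veqr (rk_Veq xb) zx.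
Qed.

Lemma Vin_vnat z n : Vin z (vnat n) <-> exists2 m, m < n & Veq z (vnat m).
Proof.
elim: n => [|n IH]; first by split=> [[[]]|[]].
rewrite [vnat _]/= Vin_succ IH; split=> [[[m lt_mn zm]|zn]|[m lt_mSn zm]].
- by exists m; first exact: ltnW.
- by exists n.
- move: lt_mSn zm; rewrite ltnS leq_eqVlt => /predU1P [->|lt_mn] zm; first by right.
  by left; exists m.
Qed.

Lemma vnat_Vin m n : m < n -> Vin (vnat m) (vnat n).
Proof. by move=> lt_mn; apply/Vin_vnat; exists m; last exact: Veq_refl. Qed.

Lemma vnat_inj m n : Veq (vnat m) (vnat n) -> m = n.
Proof.
move=> mn; case: (ltngtP m n) => // [lt_mn|lt_nm]; exfalso.
- by apply: (@Vin_irrefl (vnat n)); apply: Vin_Veql mn (vnat_Vin lt_mn).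
- by apply: (@Vin_irrefl (vnat m)); apply: Vin_Veql (Veq_sym mn) (vnat_Vin lt_nm).
Qed.

Lemma rk_sup_vnat A (f : A -> V) n :
  (forall a, exists2 m, m < n & Veq (rk (f a)) (vnat m)) ->
  exists2 m, m <= n & Veq (rk (sup A f)) (vnat m).
Proof.
elim: n => [|n IH] rkf.
  exists 0 => //; apply: Veq_ext => z; last by case/Vin_vnat.
  by case/Vin_rk => a; have [] := rkf a.
have [[a0 rk_a0]|no_n] := classic (exists a, Veq (rk (f a)) (vnat n)); last first.
  have [|m le_mn rk_m] := IH; last by exists m; first exact: leqW.
  move=> a; have [m lt_mSn rk_am] := rkf a; exists m => //.
  move: lt_mSn; rewrite ltnS leq_eqVlt => /predU1P [eq_mn|//].
  by rewrite eq_mn in rk_am; case: no_n; exists a.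
exists n.+1 => //; apply: Veq_ext => z.
- case/Vin_rk=> a /Vin_succ za; have [m lt_mSn rk_am] := rkf a.
  apply/Vin_vnat; case: za => [/(Vin_Veqr rk_am)/Vin_vnat [m' lt_m'm zm'] | za].
  + by exists m'; first exact: ltn_trans lt_mSn.
  + by exists m; last exact: Veq_trans rk_am.
- case/Vin_vnat=> m lt_mSn zm; apply/Vin_rk; exists a0; apply/Vin_succ.
  move: lt_mSn; rewrite ltnS leq_eqVlt => /predU1P [eq_mn|lt_mn].
  + by right; rewrite eq_mn in zm; apply: Veq_trans zm (Veq_sym rk_a0).
  + left; apply: Vin_Veqr (Veq_sym rk_a0) _.
    by apply: Vin_Veql (Veq_sym zm) (vnat_Vin lt_mn).
Qed.

Lemma vnat_rk_trichotomy y n :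
  [\/ Vin (vnat n) (rk y), Veq (vnat n) (rk y)
    | exists2 m, m < n & Veq (rk y) (vnat m)].
Proof.
elim: y => A f IH.
have [[a na]|below] := classic (exists a, Vin (vnat n) (Vsucc (rk (f a)))).
  by apply: Or31; apply/Vin_rk; exists a.
have [|m le_mn rk_m] := rk_sup_vnat (f := f) (n := n).
  move=> a; case: (IH a) => // na; case: below; exists a; apply/Vin_succ; tauto.
move: le_mn rk_m; rewrite leq_eqVlt => /predU1P [->|lt_mn] rk_m.
- by apply: Or32; apply: Veq_sym.
- by apply: Or33; exists m.
Qed.

Lemma vnat_Vsub_rk j x : Vsub (vnat j) (rk x) -> Vin (vnat j) (Vsucc (rk x)).
Proof.
move=> jx; apply/Vin_succ; case: (vnat_rk_trichotomy x j); [tauto | tauto |].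
case=> m lt_mj xm; exfalso; apply: (@Vin_irrefl (vnat m)).
by apply: Vin_Veqr xm (jx _ (vnat_Vin lt_mj)).
Qed.

Section MembershipChain.

Variables (x : nat -> V) (k : nat).
Hypothesis x_chain : forall i, i < k -> Vin (x i) (x i.+1).

Lemma rk_chain_lt i j : i < j -> j <= k -> Vin (rk (x i)) (rk (x j)).
Proof.
elim: j => // j IH lt_ij lt_jk; have xj := x_chain lt_jk.
move: lt_ij; rewrite ltnS leq_eqVlt => /predU1P [->|lt_ij]; first exact: rk_Vin.
by apply: rk_Vsub xj _ (IH lt_ij (ltnW lt_jk)).
Qed.

Lemma vnat_Vsub_rk_chain j : j <= k -> Vsub (vnat j) (rk (x j)).
Proof.
elim: j => [_ z /Vin_vnat [] //|j IH lt_jk z /Vin_succ zj].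
have jx := IH (ltnW lt_jk); have xj := x_chain lt_jk.
case: zj => [/jx | zj]; first exact: rk_Vsub.
apply: Vin_Veql (Veq_sym zj) _; have /Vin_succ [|j_rk] := vnat_Vsub_rk jx.
- exact: rk_Vsub.
- by apply: Vin_Veql (Veq_sym j_rk) (rk_Vin xj).
Qed.

End MembershipChain.

Lemma Vin_chain_inj T (f : T -> V) (w : nat -> T) k :
  (forall i, i < k -> Vin (f (w i)) (f (w i.+1))) ->
  {in iota 0 k.+1 &, injective w}.
Proof.
move=> chain i j; rewrite !mem_iota /= => ltiSk ltjSk wij.
case: (ltngtP i j) => // lt_ij; exfalso; apply: (@Vin_irrefl (rk (f (w i)))).
- by have := rk_chain_lt (x := f \o w) chain lt_ij ltjSk; rewrite /= wij.
- by have := rk_chain_lt (x := f \o w) chain lt_ij ltiSk; rewrite /= wij.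
Qed.

Section Construction.

Variables (phi : formula) (M Mbar : assignment) (t s : V).

Lemma Vset_vars n u : Vset phi M Mbar t n u -> u \in Vars phi.
Proof. by case: n => [|n] /= [u_phi _]. Qed.

Lemma Vset_empty_ge k :
  (forall u, ~ Vset phi M Mbar t k u) ->
  forall n, k <= n -> forall u, ~ Vset phi M Mbar t n u.
Proof.
move=> empty_k; elim=> [|n IH] le_kn u; first by case: k empty_k le_kn.
move: le_kn; rewrite leq_eqVlt => /predU1P [<-|lt_kn]; first exact: empty_k.
by case=> _ [z [_ [w [Vw _]]]]; apply: (IH lt_kn w).
Qed.

Lemma Mn_stable k :
  (forall u, ~ Vset phi M Mbar t k u) ->
  forall n, k <= n -> forall v, Mn phi M Mbar t s n v = Mn phi M Mbar t s k v.
Proof.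
move=> empty_k; elim=> [|n IH] le_kn v; first by move: le_kn; rewrite leqn0 => /eqP ->.
move: le_kn; rewrite leq_eqVlt => /predU1P [<-|lt_kn] //.
rewrite /=; case: excluded_middle_informative => [Vv|?]; last exact: IH.
by case: (Vset_empty_ge empty_k (ltnW lt_kn) Vv).
Qed.

Lemma Vset_chain k u : Vset phi M Mbar t k u ->
  exists w : nat -> nat, [/\ w k = u,
    forall i, i <= k -> Vset phi M Mbar t i (w i) &
    forall i, i < k -> Vin (M (w i)) (M (w i.+1))].
Proof.
elim: k u => [|k IH] u Vu.
  by exists (fun=> u); split=> // i; rewrite leqn0 => /eqP ->.
have [_ [z [zu [u' [Vu' zu']]]]] := Vu.
have [w [wk Vw Mw]] := IH u' Vu'.
exists (fun i => if i == k.+1 then u else w i); split; first by rewrite eqxx.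
- move=> i; case: eqP => [-> //|/eqP neq_iSk le_iSk].
  by apply: Vw; rewrite -ltnS ltn_neqAle neq_iSk.
- move=> i lt_iSk; rewrite (ltn_eqF lt_iSk) eqSS.
  case: eqP => [->|/eqP neq_ik]; first by rewrite wk; apply: Vin_Veql zu' zu.
  by apply: Mw; rewrite ltn_neqAle neq_ik.
Qed.

End Construction.

Theorem lemma3 (phi : formula) (M : assignment) (xb yb : nat)
  (Mbar : assignment) (t s : V) (k : nat) :
  sat M phi ->
  xb \in Vars phi -> yb \in Vars phi ->
  sat Mbar phi ->
  ~ Veq (Mbar xb) (Mbar yb) ->
  ((Vin t (Mbar xb) /\ ~ Vin t (Mbar yb)) \/ (Vin t (Mbar yb) /\ ~ Vin t (Mbar xb))) ->
  (* rk(s) > rk(M) = max_{u in Vars phi} rk(M u) *)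
  (forall u, u \in Vars phi -> Vin (rk (M u)) (rk s)) ->
  ((forall u, ~ Vset phi M Mbar t k u) ->
     forall n, k <= n ->
       (forall u, ~ Vset phi M Mbar t n u) /\
       (forall v, v \in Vars phi -> Veq (Mn phi M Mbar t s n v) (Mn phi M Mbar t s k v)))
  /\
  ((exists u, Vset phi M Mbar t k u) ->
     k <= size (Vars phi) - 1 /\
     (* k <= rk(M) = max_{u in Vars phi} rk(M u) *)
     exists u, u \in Vars phi /\ Vsub (vnat k) (rk (M u))).
Proof.
move=> _ _ _ _ _ _ _; split.
  move=> empty_k n le_kn; split; first exact: Vset_empty_ge.
  by move=> v _; rewrite (Mn_stable s empty_k le_kn); apply: Veq_refl.
case=> u Vu; have [w [wk Vw Mw]] := Vset_chain Vu.
split; last first.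
  exists u; split; first exact: Vset_vars Vu.
  by rewrite -wk; apply: (vnat_Vsub_rk_chain (x := M \o w) Mw).
have uniq_w : uniq (map w (iota 0 k.+1)).
  by rewrite (map_inj_in_uniq (Vin_chain_inj Mw)) iota_uniq.
have w_vars : {subset map w (iota 0 k.+1) <= Vars phi}.
  by move=> v /mapP [i]; rewrite mem_iota => /= lt_iSk ->; apply/Vset_vars/Vw.
have := leq_sub2r 1 (uniq_leq_size uniq_w w_vars).
by rewrite size_map size_iota subSS subn0.
Qed.
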